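(* Consider the family of dynamical systems on the torus $\mathbb T^2=\mathbb R^2_{\theta,\tau}/2\pi\mathbb Z^2$ $$\frac{d\theta}{d\tau}=\frac{\cos\theta+B+A\sin\tau}{\omega(1-\delta\cos\tau)}+D,$$ depending on the parameters $B,A,D\in\mathbb R$, $\omega\in\mathbb R\setminus\{0\}$, $\delta\in(0,1)$. In this family phase-lock areas exist only for integer values of the rotation number; that is, if for some $r\in\mathbb R$ the level set $\{\rho=r\}$ of the rotation number function in the parameter space has non-empty interior, then $r\in\mathbb Z$.
   Context: The rotation number of a differential equation $\frac{d\theta}{d\tau}=f(\theta,\tau)$, with $f$ being $2\pi$-periodic in $\theta$ and in $\tau$, is $\rho=\lim_{T\to+\infty}\frac{\theta(T)}{T}\in\mathbb R$, where $\theta(\tau)$ is an arbitrary real-valued (lifted) solution; the limit exists and does not depend on the solution. For a family of such equations, the rotation number function assigns to a parameter value the rotation number of the corresponding equation. The phase-lock areas are those level sets of the rotation number function in the parameter space that have non-empty interior. *)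

(* Defs.v *)
From Stdlib Require Import Reals.
From Coquelicot Require Import Coquelicot.
Open Scope R_scope.

(** For [f] smooth and periodic in its first argument all solutions are global,
    so a (lifted) solution is taken to be defined on the whole line. *)
Definition is_solution (f : R -> R -> R) (theta : R -> R) : Prop :=
  forall tau : R, is_derive theta tau (f (theta tau) tau).

(** The graph of the rotation number function.  The existence clause keeps the
    relation functional in [rho] for every [f]: without it, an equation with no
    solution would have every real as a rotation number. *)
Definition is_rotation_number (f : R -> R -> R) (rho : R) : Prop :=
  (exists theta : R -> R, is_solution f theta) /\
  (forall theta : R -> R, is_solution f theta ->
     is_lim (fun T => theta T / T) p_infty rho).

Definition torus_field (B A D omega delta theta tau : R) : R :=
  (cos theta + B + A * sin tau) / (omega * (1 - delta * cos tau)) + D.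

(** The quintuple is [(B, A, D, omega, delta)]. *)
Definition param_space (p : R * R * R * R * R) : Prop :=
  let '(_, _, _, omega, delta) := p in omega <> 0 /\ 0 < delta < 1.

Definition level_set (r : R) (p : R * R * R * R * R) : Prop :=
  param_space p /\
  let '(B, A, D, omega, delta) := p in
  is_rotation_number (torus_field B A D omega delta) r.

Definition interior {T : UniformSpace} (S : T -> Prop) (x : T) : Prop :=
  locally x S.

(** [param_space] is open in [R^5], so the interior in [R^5] is also the interior
    relative to [param_space]. *)
Definition is_phase_lock_value (r : R) : Prop :=
  exists p : R * R * R * R * R, interior (level_set r) p.

(* Main.v *)
Require Import Defs.
From Stdlib Require Import Reals Lra.
From Coquelicot Require Import Coquelicot.
Open Scope R_scope.

(** For fixed parameters the equation has the form
    [theta' = a(t) cos theta + b(t)] with [a], [b] of period [2 PI], and moving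
    [D] adds a constant [eps] to [b].  Such an equation is a Riccati equation in
    [tan (theta / 2)]: its solutions are the doubled polar angles of the
    solutions of the planar linear system
    [X' = (a - b) / 2 * Y], [Y' = (a + b) / 2 * X], whose time-[2 PI] map lies in
    [SL(2, R)].  A given solution [theta] yields, by one quadrature, a vector
    solution [v0]; its shift [v1(t) = v0(t + 2 PI)] is another one, and
    [w = det (v0, v1)] is constant.

    If [w = 0], then [theta(t + 2 PI) - theta(t)] is a constant integer multiple
    of [2 PI], so the rotation number is an integer.  If [w <> 0], then the second
    shift satisfies [v2 = beta v1 - v0], where [beta] is the trace of the
    time-[2 PI] map ([three_term_recurrence]).

    If [beta^2 >= 4], this map has a real eigenvector, so some solution of the
    linear system keeps its direction after a period.  Since it is never parallel
    to [v0], its angle stays at bounded distance from [theta], and the rotation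
    number is again an integer ([integer_of_real_multiplier]).

    If [beta^2 < 4], the map preserves a positive definite quadratic form, which
    makes the equation conjugate to a rigid rotation: there is a bounded change
    of angle [u] after which the velocity does not depend on the angle
    ([straightened_angle_derive]).  The same change of angle applied to the
    equation with [b + eps] adds to the velocity a term bounded below by a
    positive constant, hence the rotation number increases strictly
    ([drift_of_bounded_invariant_form]).  It therefore cannot be constant on an
    open set of parameters. *)

(** * Calculus on the line and rotation numbers *)

Lemma constant_of_derive_zero (g : R -> R) :
  (forall t, is_derive g t 0) -> forall s t, g s = g t.
Proof.
intros Hg s t.
destruct (Rtotal_order s t) as [H | [-> | H]].
- now apply (eq_is_derive g); [intros; apply Hg|].
- reflexivity.
- symmetry; now apply (eq_is_derive g); [intros; apply Hg|].
Qed.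

Lemma is_derive_continuity_pt (g : R -> R) (t l : R) :
  is_derive g t l -> continuity_pt g t.
Proof.
intros H; apply continuity_pt_filterlim.
apply (ex_derive_continuous (V := R_NormedModule)); now exists l.
Qed.

Lemma linear_growth (g dg : R -> R) (kappa : R) :
  (forall t, is_derive g t (dg t)) -> (forall t, 0 <= t -> kappa <= dg t) ->
  forall t, 0 <= t -> g 0 + kappa * t <= g t.
Proof.
intros Hg Hk t Ht.
destruct (MVT_gen g 0 t dg) as [x [Hx E]].
- intros; apply Hg.
- intros; eapply is_derive_continuity_pt, Hg.
- rewrite Rmin_left in Hx by lra.
  assert (kappa <= dg x) by (apply Hk; lra).
  nra.
Qed.

Lemma bounded_periodic (g : R -> R) (P : R) :
  0 < P -> (forall t, continuity_pt g t) -> (forall t, g (t + P) = g t) ->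
  exists M, forall t, 0 <= t -> g t <= M.
Proof.
intros HP Hc Hper.
destruct (continuity_ab_maj g 0 P) as [m [Hm _]]; [lra | intros; apply Hc |].
exists (g m).
assert (H : forall n s, 0 <= s <= P * INR (S n) -> g s <= g m).
{ induction n as [|n IH]; intros s Hs.
  - apply Hm; simpl in Hs; lra.
  - destruct (Rle_dec s P) as [HsP | HsP]; [apply Hm; lra|].
    replace s with ((s - P) + P) by ring; rewrite Hper; apply IH.
    rewrite S_INR in Hs; lra. }
intros t Ht.
destruct (nfloor_ex (t / P)) as [n Hn].
{ apply Rdiv_le_0_compat; lra. }
apply (H n); split; [lra|].
rewrite S_INR; replace t with (P * (t / P)) by (field; lra).
apply Rmult_le_compat_l; lra.
Qed.

Lemma bounded_div_lim0 (g : R -> R) (C : R) :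
  (forall t, Rabs (g t) <= C) -> is_lim (fun T => g T / T) p_infty 0.
Proof.
intros Hg.
assert (L : forall k, is_lim (fun T => k * / T) p_infty 0).
{ intros k; replace (Finite 0) with (Rbar_mult k 0) by (simpl; f_equal; ring).
  apply is_lim_scal_l.
  replace (Finite 0) with (Rbar_inv p_infty) by reflexivity.
  apply is_lim_inv; [apply is_lim_id | discriminate]. }
apply is_lim_le_le_loc with (2 := L (- C)) (3 := L C).
exists 0; intros T HT.
assert (0 < / T) by now apply Rinv_0_lt_compat.
specialize (Hg T); apply Rabs_le_between in Hg.
unfold Rdiv; nra.
Qed.

Lemma rotation_bounded_perturbation (theta psi : R -> R) (C r : R) :
  (forall t, Rabs (psi t - theta t) <= C) ->
  is_lim (fun T => theta T / T) p_infty r ->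
  is_lim (fun T => psi T / T) p_infty r.
Proof.
intros HC Hl.
replace (Finite r) with (Finite (r + 0)) by (f_equal; ring).
apply is_lim_ext with (fun T => theta T / T + (psi T - theta T) / T).
{ intros T; unfold Rdiv; ring. }
apply (is_lim_plus' _ _ _ _ _ Hl (bounded_div_lim0 _ _ HC)).
Qed.

Lemma no_linear_drift (theta phi : R -> R) (kappa C r : R) :
  0 < kappa -> (forall t, 0 <= t -> kappa * t - C <= phi t - theta t) ->
  is_lim (fun T => theta T / T) p_infty r ->
  is_lim (fun T => phi T / T) p_infty r -> False.
Proof.
intros Hk Hd H1 H2.
assert (H3 := is_lim_minus' _ _ _ _ _ H2 H1).
assert (H4 : is_lim (fun T => C / T) p_infty 0).
{ apply (bounded_div_lim0 (fun _ => C) (Rabs C)); intros; lra. }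
assert (H5 := is_lim_plus' _ _ _ _ _ H3 H4).
assert (H6 : Rbar_le kappa (r - r + 0)).
{ refine (is_lim_le_loc _ _ _ _ _ _ (is_lim_const kappa p_infty) H5).
  exists 0; intros T HT; specialize (Hd T (Rlt_le _ _ HT)).
  apply Rmult_le_reg_r with T; [lra|].
  field_simplify; lra. }
simpl in H6; lra.
Qed.

(** The increment of [psi / 2] over a period is a continuous function with values
    in the discrete set [PI Z], hence constant, and this constant is read off
    along the times [2 PI n].  Only the direction of a planar curve, as opposed to
    a solution of a differential equation, is involved, so the lemma also applies
    to a lifted angle built by hand. *)
Lemma integer_rotation_of_closed_direction (psi : R -> R) (r : R) :
  (forall t, ex_derive psi t) ->
  (forall t, sin ((psi (t + 2 * PI) - psi t) / 2) = 0) ->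
  is_lim (fun T => psi T / T) p_infty r -> exists n : Z, r = IZR n.
Proof.
intros Hd Hs Hl.
pose (g := fun t => (psi (t + 2 * PI) - psi t) / 2).
assert (Hg : forall t, is_derive g t 0).
{ intros t.
  assert (Dg : ex_derive g t) by (unfold g; auto_derive; repeat split; apply Hd).
  assert (D0 : is_derive (fun t => sin (g t)) t (Derive g t * cos (g t))).
  { auto_derive; [assumption | apply f_equal2; [apply Rmult_1_l | reflexivity]]. }
  assert (D1 : is_derive (fun t => sin (g t)) t 0).
  { apply (is_derive_ext (fun _ => 0)); [intros s; symmetry; apply Hs|].
    apply (is_derive_const 0 t). }
  assert (E : Derive g t * cos (g t) = 0).
  { rewrite <- (is_derive_unique _ _ _ D0); exact (is_derive_unique _ _ _ D1). }
  assert (T := sin2_cos2 (g t)); unfold Rsqr in T.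
  replace (sin (g t)) with 0 in T by (symmetry; apply Hs).
  replace 0 with (Derive g t)
    by (destruct (Rmult_integral _ _ E) as [H | H]; [exact H | rewrite H in T; lra]).
  now apply Derive_correct. }
destruct (sin_eq_0_0 (g 0) (Hs 0)) as [k Hk]; exists k.
assert (Hn : forall n, psi (2 * PI * INR n) = psi 0 + 2 * PI * IZR k * INR n).
{ induction n as [|n IH].
  - simpl; rewrite !Rmult_0_r; ring.
  - assert (G := constant_of_derive_zero g Hg (2 * PI * INR n) 0).
    rewrite Hk in G; unfold g in G; rewrite S_INR.
    replace (2 * PI * (INR n + 1)) with (2 * PI * INR n + 2 * PI) by ring.
    lra. }
assert (P := PI_RGT_0).
assert (U : is_lim_seq (fun n => 2 * PI * INR n) p_infty).
{ replace p_infty with (Rbar_mult (2 * PI) p_infty).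
  - apply is_lim_seq_scal_l, is_lim_seq_INR.
  - simpl; case Rle_dec; [|lra]; intros H; case Rle_lt_or_eq_dec; lra || reflexivity. }
assert (V : eventually (fun n => Finite (2 * PI * INR n) <> p_infty)).
{ exists O; intros; discriminate. }
assert (L1 := is_lim_comp_seq _ _ _ _ Hl V U).
assert (L0 : is_lim (fun T => (psi 0 + IZR k * T) / T) p_infty (IZR k)).
{ apply rotation_bounded_perturbation with (fun T => IZR k * T) (Rabs (psi 0)).
  - intros t; right; f_equal; ring.
  - apply is_lim_ext_loc with (fun _ => IZR k); [|apply is_lim_const].
    exists 0; intros; field; lra. }
assert (L2 := is_lim_comp_seq _ _ _ _ L0 V U).
apply is_lim_seq_unique in L1; apply is_lim_seq_unique in L2.
assert (E : Finite r = Finite (IZR k)); [|now injection E].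
rewrite <- L1, <- L2; apply Lim_seq_ext; intros n; rewrite Hn; f_equal; ring.
Qed.

(** * Straightening by an invariant form *)

(** The function [q(theta, t) = p0 + p1 cos theta + p2 sin theta] satisfies
    [q_t + f q_theta = q f_theta] for [f = a cos theta + b]; where [q] does not
    vanish, this says that the flow of [f] transports the density [1 / q].  The
    determinant [p0^2 - p1^2 - p2^2] is a first integral. *)
Definition invariant_form (a b p0 p1 p2 : R -> R) : Prop :=
  forall t,
    is_derive p0 t (- a t * p2 t) /\
    is_derive p1 t (- b t * p2 t) /\
    is_derive p2 t (b t * p1 t - a t * p0 t).

Definition form_value (p0 p1 p2 theta : R) : R :=
  p0 + p1 * cos theta + p2 * sin theta.

Definition form_slope (p1 p2 theta : R) : R :=
  p2 * cos theta - p1 * sin theta.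

(** With [N = q_theta], this is [N^2 + (q - p0)^2 = p1^2 + p2^2]. *)
Lemma form_identity (p0 p1 p2 c theta : R) :
  c * c = p0 * p0 - p1 * p1 - p2 * p2 ->
  let q := form_value p0 p1 p2 theta in
  let N := form_slope p1 p2 theta in
  N * N = 2 * q * p0 - c * c - q * q.
Proof.
intros Hc; cbv zeta; unfold form_value, form_slope; rewrite Hc.
assert (T := sin2_cos2 theta); unfold Rsqr in T.
assert (T' : sin theta * sin theta = 1 - cos theta * cos theta) by lra.
ring [T'].
Qed.

Lemma form_value_bounds (p0 p1 p2 c theta : R) :
  0 < p0 -> 0 < c -> c * c = p0 * p0 - p1 * p1 - p2 * p2 ->
  0 < form_value p0 p1 p2 theta <= 2 * p0.
Proof.
intros Hp Hc E.
assert (I := form_identity p0 p1 p2 c theta E); cbv zeta in I.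
set (q := form_value p0 p1 p2 theta) in *.
set (N := form_slope p1 p2 theta) in *.
assert (Hc2 : 0 < c * c) by now apply Rmult_lt_0_compat.
assert (HN := Rle_0_sqr N); assert (Hq := Rle_0_sqr q); unfold Rsqr in *.
assert (0 < q) by (apply Rmult_lt_reg_r with p0; lra).
split; [assumption | apply Rmult_le_reg_l with q; lra].
Qed.

(** The angle [u = theta + 2 atan (q_theta / (q + c))] is a primitive of [c / q]
    in [theta].  It is the argument of the image of [exp (i theta)] under the
    automorphism of the unit disc that sends
    [z = - (p1 + i p2) / (p0 + c)] to the origin: [z] follows the complexified
    Riccati flow, and moving it to the centre turns that flow into rotations.
    Writing [u] through [atan] is legitimate because [1 - z exp (- i theta)],
    whose argument is half of [u - theta], has positive real part; this also
    gives [|u - theta| < PI] without any lifting argument. *)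
Lemma straightened_angle_derive
    (a b p0 p1 p2 theta : R -> R) (c eps t : R) :
  invariant_form a b p0 p1 p2 -> 0 < p0 t -> 0 < c ->
  c * c = p0 t * p0 t - p1 t * p1 t - p2 t * p2 t ->
  is_derive theta t (a t * cos (theta t) + b t + eps) ->
  is_derive (fun s => theta s +
      2 * atan (form_slope (p1 s) (p2 s) (theta s) /
                (form_value (p0 s) (p1 s) (p2 s) (theta s) + c))) t
    (b t - a t * p1 t / (p0 t + c)
     + eps * c / form_value (p0 t) (p1 t) (p2 t) (theta t)).
Proof.
intros HI Hp Hc E Hth.
destruct (HI t) as [D0 [D1 D2]].
assert (I := form_identity (p0 t) (p1 t) (p2 t) c (theta t) E); cbv zeta in I.
destruct (form_value_bounds _ _ _ _ (theta t) Hp Hc E) as [Hq _].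
assert (T := sin2_cos2 (theta t)); unfold Rsqr in T.
assert (T' : sin (theta t) * sin (theta t) = 1 - cos (theta t) * cos (theta t))
  by lra.
assert (Dq : is_derive (fun s => form_value (p0 s) (p1 s) (p2 s) (theta s)) t
  (- a t * sin (theta t) * form_value (p0 t) (p1 t) (p2 t) (theta t)
   + eps * form_slope (p1 t) (p2 t) (theta t))).
{ unfold form_value, form_slope; auto_derive.
  - repeat split; eexists; eassumption.
  - rewrite (is_derive_unique (fun x : R => p0 x) _ _ D0), (is_derive_unique (fun x : R => p1 x) _ _ D1),
      (is_derive_unique (fun x : R => p2 x) _ _ D2), (is_derive_unique (fun x : R => theta x) _ _ Hth).
    ring [T']. }
assert (DN : is_derive (fun s => form_slope (p1 s) (p2 s) (theta s)) t
  (- a t * cos (theta t) * form_value (p0 t) (p1 t) (p2 t) (theta t)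
   - eps * (form_value (p0 t) (p1 t) (p2 t) (theta t) - p0 t))).
{ unfold form_value, form_slope; auto_derive.
  - repeat split; eexists; eassumption.
  - rewrite (is_derive_unique (fun x : R => p1 x) _ _ D1),
      (is_derive_unique (fun x : R => p2 x) _ _ D2), (is_derive_unique (fun x : R => theta x) _ _ Hth).
    ring [T']. }
assert (J : cos (theta t) * (form_value (p0 t) (p1 t) (p2 t) (theta t) + c)
   - sin (theta t) * form_slope (p1 t) (p2 t) (theta t)
   = cos (theta t) * (p0 t + c) + p1 t).
{ unfold form_value, form_slope; ring [T']. }
set (fq := fun s => form_value (p0 s) (p1 s) (p2 s) (theta s)) in *.
set (fN := fun s => form_slope (p1 s) (p2 s) (theta s)) in *.
change (form_value (p0 t) (p1 t) (p2 t) (theta t)) with (fq t) in *.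
change (form_slope (p1 t) (p2 t) (theta t)) with (fN t) in *.
apply is_derive_ext with (fun s => theta s + 2 * atan (fN s / (fq s + c))).
{ reflexivity. }
auto_derive.
- repeat split; try (eexists; eassumption); lra.
- rewrite (is_derive_unique (fun x : R => fq x) _ _ Dq), (is_derive_unique (fun x : R => fN x) _ _ DN),
    (is_derive_unique (fun x : R => theta x) _ _ Hth).
  clearbody fq fN.
  generalize dependent (fq t); generalize dependent (fN t).
  intros N q I Hq Dq DN J.
  transitivity (a t * cos (theta t) + b t + eps +
    2 * ((- a t * cos (theta t) * q - eps * (q - p0 t)) * (q + c)
         - N * (- a t * sin (theta t) * q + eps * N))
      / ((q + c) * (q + c) + N * N)).
  { assert (0 <= N * N) by apply Rle_0_sqr.
    assert (0 < (q + c) * (q + c)) by (apply Rmult_lt_0_compat; lra).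
    field; repeat split; nra || lra. }
  replace ((- a t * cos (theta t) * q - eps * (q - p0 t)) * (q + c)
         - N * (- a t * sin (theta t) * q + eps * N))
    with (- a t * q * (cos (theta t) * (q + c) - sin (theta t) * N)
          - eps * ((q - p0 t) * (q + c) + N * N)) by ring.
  rewrite J, I.
  replace ((q + c) * (q + c) + (2 * q * p0 t - c * c - q * q))
    with (2 * q * (p0 t + c)) by ring.
  field; lra.
Qed.

(** In the angle [u] both solutions have the same velocity except for the term
    [eps * c / q >= eps * c / (2 * M)], so their distance grows linearly. *)
Lemma drift_of_bounded_invariant_form
    (a b p0 p1 p2 theta phi : R -> R) (c M eps r : R) :
  invariant_form a b p0 p1 p2 -> 0 < c -> 0 < eps ->
  (forall t, 0 < p0 t) -> (forall t, 0 <= t -> p0 t <= M) ->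
  (forall t, c * c = p0 t * p0 t - p1 t * p1 t - p2 t * p2 t) ->
  (forall t, is_derive theta t (a t * cos (theta t) + b t)) ->
  (forall t, is_derive phi t (a t * cos (phi t) + b t + eps)) ->
  is_lim (fun T => theta T / T) p_infty r ->
  is_lim (fun T => phi T / T) p_infty r -> False.
Proof.
intros HI Hc Heps Hp HM E Hth Hphi.
assert (M0 : 0 < M) by (specialize (Hp 0); specialize (HM 0 (Rle_refl 0)); lra).
set (corr := fun (x : R -> R) s =>
  2 * atan (form_slope (p1 s) (p2 s) (x s) /
            (form_value (p0 s) (p1 s) (p2 s) (x s) + c))).
assert (B : forall x s, - PI < corr x s < PI).
{ intros x s; unfold corr.
  match goal with |- context [atan ?y] => destruct (atan_bound y) end; lra. }
assert (D1 : forall t, is_derive (fun s => theta s + corr theta s) t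
  (b t - a t * p1 t / (p0 t + c)
   + 0 * c / form_value (p0 t) (p1 t) (p2 t) (theta t))).
{ intros t; apply straightened_angle_derive; auto.
  rewrite Rplus_0_r; apply Hth. }
assert (D2 : forall t, is_derive (fun s => phi s + corr phi s) t
  (b t - a t * p1 t / (p0 t + c)
   + eps * c / form_value (p0 t) (p1 t) (p2 t) (phi t))).
{ intros t; apply straightened_angle_derive; auto. }
assert (G := linear_growth _ _ (eps * c / (2 * M))
  (fun t => is_derive_minus _ _ _ _ _ (D2 t) (D1 t))).
assert (Hk : 0 < eps * c / (2 * M)).
{ apply Rdiv_lt_0_compat; [now apply Rmult_lt_0_compat | lra]. }
apply (no_linear_drift theta phi (eps * c / (2 * M))
  (4 * PI - (phi 0 - theta 0)) r Hk).
intros t Ht; cbv beta in G.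
assert (G' : phi 0 + corr phi 0 - (theta 0 + corr theta 0)
  + eps * c / (2 * M) * t
  <= phi t + corr phi t - (theta t + corr theta t)).
{ apply G; [|exact Ht].
  intros s Hs; specialize (HM s Hs).
  destruct (form_value_bounds _ _ _ _ (phi s) (Hp s) Hc (E s)) as [Q1 Q2].
  set (q := form_value (p0 s) (p1 s) (p2 s) (phi s)) in *.
  unfold minus, plus, opp; simpl.
  assert (eps * c / (2 * M) <= eps * c / q).
  { apply Rmult_le_compat_l; [left; now apply Rmult_lt_0_compat|].
    apply Rinv_le_contravar; lra. }
  rewrite (Rmult_0_l c), Rdiv_0_l; lra. }
generalize (B phi 0) (B phi t) (B theta 0) (B theta t); lra.
Qed.

(** * The linear system behind the equation *)

Definition linear_solution (a b X Y : R -> R) : Prop :=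
  forall t,
    is_derive X t ((a t - b t) / 2 * Y t) /\
    is_derive Y t ((a t + b t) / 2 * X t).

(** Along a given angle the system leaves one scalar equation for the radius,
    [rho' = a sin theta / 2 * rho], which is solved by the exponential of an
    integral. *)
Lemma linear_solution_of_angle (a b theta : R -> R) :
  (forall t, continuity_pt a t) ->
  (forall t, is_derive theta t (a t * cos (theta t) + b t)) ->
  exists rho : R -> R, (forall t, 0 < rho t) /\
    linear_solution a b (fun t => rho t * cos (theta t / 2))
                        (fun t => rho t * sin (theta t / 2)).
Proof.
intros Ca Hth.
assert (Cs : forall t, continuous (fun s => a s * sin (theta s) / 2) t).
{ intros t; apply continuity_pt_filterlim.
  apply (continuity_pt_mult (fun s => a s * sin (theta s)) (fun _ => / 2)).
  - apply (continuity_pt_mult a (fun s => sin (theta s))); [apply Ca|].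
    apply (continuity_pt_comp theta sin); [|apply continuity_sin].
    eapply is_derive_continuity_pt, Hth.
  - apply continuity_pt_const; intros x y; reflexivity. }
pose (L := fun t => RInt (fun s => a s * sin (theta s) / 2) 0 t).
assert (DL : forall t, is_derive L t (a t * sin (theta t) / 2)).
{ intros t; apply (is_derive_RInt (fun s => a s * sin (theta s) / 2) L 0 t);
    [|apply Cs].
  apply filter_forall; intros x; apply (RInt_correct (V := R_CompleteNormedModule)).
  apply (ex_RInt_continuous (V := R_CompleteNormedModule)); intros; apply Cs. }
exists (fun t => exp (L t)); split; [intros; apply exp_pos|].
intros t; clearbody L.
assert (Ed : theta t = 2 * (theta t / 2)) by field.
assert (Es := sin_2a (theta t / 2)); rewrite <- Ed in Es.
assert (Ec := cos_2a (theta t / 2)); rewrite <- Ed in Ec.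
assert (T := sin2_cos2 (theta t / 2)); unfold Rsqr in T.
split; auto_derive;
  try (repeat split; eexists; (apply DL || apply Hth));
  rewrite (is_derive_unique (fun x : R => L x) _ _ (DL t)),
    (is_derive_unique (fun x : R => theta x) _ _ (Hth t));
  rewrite Es, Ec; set (k := sin (theta t / 2)) in *;
  set (h := cos (theta t / 2)) in *;
  assert (T' : k * k = 1 - h * h) by lra.
  - change (theta t * / 2) with (theta t / 2); fold k h. field [T'].
  - change (theta t * / 2) with (theta t / 2); fold k h. field [T'].
Qed.

Lemma linear_solution_shift (a b X Y : R -> R) (P : R) :
  (forall t, a (t + P) = a t) -> (forall t, b (t + P) = b t) ->
  linear_solution a b X Y ->
  linear_solution a b (fun t => X (t + P)) (fun t => Y (t + P)).
Proof.
intros Ha Hb H t; destruct (H (t + P)) as [HX HY].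
rewrite Ha, Hb in HX, HY.
split; auto_derive; try (eexists; eassumption).
- rewrite (is_derive_unique (fun x : R => X x) _ _ HX); ring.
- rewrite (is_derive_unique (fun x : R => Y x) _ _ HY); ring.
Qed.

Lemma wronskian_constant (a b X Y U V : R -> R) :
  linear_solution a b X Y -> linear_solution a b U V ->
  forall s t, X s * V s - Y s * U s = X t * V t - Y t * U t.
Proof.
intros H1 H2.
apply (constant_of_derive_zero (fun t => X t * V t - Y t * U t)).
intros t; destruct (H1 t) as [DX DY]; destruct (H2 t) as [DU DV].
auto_derive; [repeat split; eexists; eassumption|].
rewrite (is_derive_unique (fun x : R => X x) _ _ DX),
  (is_derive_unique (fun x : R => Y x) _ _ DY),
  (is_derive_unique (fun x : R => U x) _ _ DU),
  (is_derive_unique (fun x : R => V x) _ _ DV).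
field.
Qed.

(** For [v = (X, Y)] and [v' = (U, V)] the three functions are the coefficients of
    [d^2 + d'^2 - beta d d'], where [d] and [d'] are the determinants of
    [(cos (theta / 2), sin (theta / 2))] with [v] and [v'].  Every
    constant quadratic form in [d] and [d'] solves these equations; this one is invariant under
    [(d, d') |-> (d', beta d' - d)], that is, under a shift by one period. *)
Lemma invariant_form_of_linear_solutions (a b X Y U V : R -> R) (beta : R) :
  linear_solution a b X Y -> linear_solution a b U V ->
  invariant_form a b
    (fun t => (Y t * Y t + X t * X t + (V t * V t + U t * U t)
               - beta * (Y t * V t + X t * U t)) / 2)
    (fun t => (Y t * Y t - X t * X t + (V t * V t - U t * U t)
               - beta * (Y t * V t - X t * U t)) / 2)
    (fun t => - X t * Y t - U t * V t + beta * (X t * V t + Y t * U t) / 2).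
Proof.
intros H1 H2 t; destruct (H1 t) as [DX DY]; destruct (H2 t) as [DU DV].
split; [|split]; (auto_derive; [repeat split; eexists; eassumption|]);
rewrite (is_derive_unique (fun x : R => X x) _ _ DX),
  (is_derive_unique (fun x : R => Y x) _ _ DY),
  (is_derive_unique (fun x : R => U x) _ _ DU),
  (is_derive_unique (fun x : R => V x) _ _ DV); field.
Qed.

(** * The two types of monodromy *)

(** A real eigenvector gives a solution [(U, V) = v1 - lambda v0] whose direction
    is closed up after a period.  In the moving frame formed by [v0] and its
    rotation by a right angle, [(U, V)] has its second coordinate of constant sign
    because [det (v0, (U, V)) = w]; so an angle of it, doubled, is
    [theta + PI - 2 atan xi] with [xi] the ratio of the coordinates, and this
    angle stays within [2 PI] of [theta]. *)
Lemma integer_of_real_multiplier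
    (rho theta X Y : R -> R) (w beta r : R) :
  (forall t, 0 < rho t) -> (forall t, ex_derive theta t) ->
  (forall t, ex_derive X t) -> (forall t, ex_derive Y t) ->
  (forall t, X t = rho t * cos (theta t / 2)) ->
  (forall t, Y t = rho t * sin (theta t / 2)) ->
  w <> 0 -> (forall t, X t * Y (t + 2 * PI) - Y t * X (t + 2 * PI) = w) ->
  (forall t, X (t + 2 * PI + 2 * PI) = beta * X (t + 2 * PI) - X t) ->
  (forall t, Y (t + 2 * PI + 2 * PI) = beta * Y (t + 2 * PI) - Y t) ->
  4 <= beta * beta ->
  is_lim (fun T => theta T / T) p_infty r -> exists n : Z, r = IZR n.
Proof.
intros Hrho Dth DX DY EX EY Hw W RX RY Hb Hl.
(* [lambda] and [beta - lambda] are the two eigenvalues. *)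
destruct (Rle_dec 0 (beta * beta - 4)) as [Hdisc|]; [|lra].
pose (lambda := (beta + sqrt (beta * beta - 4)) / 2).
assert (Hlam : lambda * (beta - lambda) = 1).
{ unfold lambda; assert (S := sqrt_sqrt _ Hdisc).
  set (s := sqrt _) in *; field_simplify; nra. }
clearbody lambda.
pose (U := fun t => X (t + 2 * PI) - lambda * X t).
pose (V := fun t => Y (t + 2 * PI) - lambda * Y t).
assert (EU : forall t, U (t + 2 * PI) = (beta - lambda) * U t).
{ intros t; unfold U; rewrite RX.
  transitivity ((beta - lambda) * X (t + 2 * PI) - 1 * X t); [ring|].
  rewrite <- Hlam; ring. }
assert (EV : forall t, V (t + 2 * PI) = (beta - lambda) * V t).
{ intros t; unfold V; rewrite RY.
  transitivity ((beta - lambda) * Y (t + 2 * PI) - 1 * Y t); [ring|].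
  rewrite <- Hlam; ring. }
pose (xi := fun t => (U t * X t + V t * Y t) / w).
pose (psi := fun t => theta t + PI - 2 * atan (xi t)).
assert (Dxi : forall t, ex_derive xi t).
{ intros t; unfold xi, U, V; auto_derive; repeat split; auto. }
assert (Hpar : forall t, exists k,
  cos (psi t / 2) = k * U t /\ sin (psi t / 2) = k * V t).
{ intros t; exists (cos (atan (xi t)) * rho t / w).
  assert (Es : sin (atan (xi t)) = xi t * cos (atan (xi t))).
  { rewrite sin_atan, cos_atan; unfold Rdiv; ring. }
  assert (Ep : psi t / 2 = theta t / 2 + (PI / 2 - atan (xi t))).
  { unfold psi; field. }
  rewrite Ep, cos_plus, sin_plus, cos_shift, sin_shift, Es.
  assert (W' : X t * V t - Y t * U t = w).
  { rewrite <- (W t); unfold U, V; ring. }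
  assert (T := sin2_cos2 (theta t / 2)); unfold Rsqr in T.
  assert (N : X t * X t + Y t * Y t = rho t * rho t).
  { rewrite EX, EY. transitivity (rho t * rho t *
      (sin (theta t / 2) * sin (theta t / 2) + cos (theta t / 2) * cos (theta t / 2)));
      [ring | rewrite T; ring]. }
  specialize (Hrho t).
  assert (Ec : cos (theta t / 2) = X t / rho t) by (rewrite EX; field; lra).
  assert (Ek : sin (theta t / 2) = Y t / rho t) by (rewrite EY; field; lra).
  rewrite Ec, Ek.
  assert (Exi : xi t * w = U t * X t + V t * Y t) by (unfold xi; field; auto).
  split; apply Rmult_eq_reg_r with (w * rho t);
    try (apply Rmult_integral_contrapositive_currified; lra).
  - transitivity (cos (atan (xi t)) * (xi t * w * X t - w * Y t)); [field; lra|].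
    transitivity (cos (atan (xi t)) * (rho t * rho t) * U t); [|field; lra].
    rewrite Exi, <- N, <- W'; ring.
  - transitivity (cos (atan (xi t)) * (xi t * w * Y t + w * X t)); [field; lra|].
    transitivity (cos (atan (xi t)) * (rho t * rho t) * V t); [|field; lra].
    rewrite Exi, <- N, <- W'; ring. }
apply (integer_rotation_of_closed_direction psi).
- intros t; unfold psi.
  apply (ex_derive_minus (fun t => theta t + PI) (fun t => 2 * atan (xi t))).
  + auto_derive; auto.
  + auto_derive; auto.
- intros t.
  replace ((psi (t + 2 * PI) - psi t) / 2) with (psi (t + 2 * PI) / 2 - psi t / 2)
    by field.
  rewrite sin_minus.
  destruct (Hpar t) as [k [-> ->]]; destruct (Hpar (t + 2 * PI)) as [l [-> ->]].
  rewrite EU, EV; ring.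
- apply (rotation_bounded_perturbation theta psi (2 * PI)); [|exact Hl].
  intros t; unfold psi; destruct (atan_bound (xi t)); apply Rabs_le; lra.
Qed.

(** When [beta^2 < 4] the form [d^2 + d'^2 - beta d d'] is positive definite, of
    determinant [(1 - beta^2 / 4) w^2], and periodic, hence bounded. *)
Lemma no_locking_of_elliptic_multiplier
    (a b theta phi X Y : R -> R) (w beta eps r : R) :
  linear_solution a b X Y ->
  linear_solution a b (fun t => X (t + 2 * PI)) (fun t => Y (t + 2 * PI)) ->
  w <> 0 -> (forall t, X t * Y (t + 2 * PI) - Y t * X (t + 2 * PI) = w) ->
  (forall t, X (t + 2 * PI + 2 * PI) = beta * X (t + 2 * PI) - X t) ->
  (forall t, Y (t + 2 * PI + 2 * PI) = beta * Y (t + 2 * PI) - Y t) ->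
  beta * beta < 4 -> 0 < eps ->
  (forall t, is_derive theta t (a t * cos (theta t) + b t)) ->
  (forall t, is_derive phi t (a t * cos (phi t) + b t + eps)) ->
  is_lim (fun T => theta T / T) p_infty r ->
  is_lim (fun T => phi T / T) p_infty r -> False.
Proof.
intros L0 L1 Hw W RX RY Hb Heps Hth Hphi Hl Hl'.
assert (HI := invariant_form_of_linear_solutions a b X Y _ _ beta L0 L1).
cbv beta in HI.
match type of HI with invariant_form _ _ ?f0 ?f1 ?f2 =>
  set (p0 := f0) in HI; set (p1 := f1) in HI; set (p2 := f2) in HI end.
assert (Hw2 : 0 < w * w) by (apply Rsqr_pos_lt in Hw; exact Hw).
pose (c2 := (1 - beta * beta / 4) * (w * w)).
assert (Hc2 : 0 < c2) by (apply Rmult_lt_0_compat; lra).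
assert (E : forall t,
  sqrt c2 * sqrt c2 = p0 t * p0 t - p1 t * p1 t - p2 t * p2 t).
{ intros t; rewrite sqrt_sqrt by lra.
  unfold c2, p0, p1, p2; rewrite <- (W t); field. }
assert (Hp : forall t, 0 < p0 t).
{ intros t.
  assert (P : 0 <= p0 t).
  { unfold p0; set (x := X t); set (y := Y t).
    set (u := X (t + 2 * PI)); set (v := Y (t + 2 * PI)).
    (* Completing the squares of [v0 - beta / 2 * v1]. *)
    replace ((y * y + x * x + (v * v + u * u) - beta * (y * v + x * u)) / 2)
      with ((Rsqr (y - beta / 2 * v) + Rsqr (x - beta / 2 * u)
             + (1 - beta * beta / 4) * (Rsqr u + Rsqr v)) / 2)
      by (unfold Rsqr; field).
    assert (0 <= (1 - beta * beta / 4) * (Rsqr u + Rsqr v)).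
    { apply Rmult_le_pos; [lra|]. generalize (Rle_0_sqr u) (Rle_0_sqr v); lra. }
    generalize (Rle_0_sqr (y - beta / 2 * v)) (Rle_0_sqr (x - beta / 2 * u)); lra. }
  destruct P as [P | P]; [exact P|].
  specialize (E t); rewrite sqrt_sqrt, <- P in E by lra.
  generalize (Rle_0_sqr (p1 t)) (Rle_0_sqr (p2 t)); unfold Rsqr; lra. }
destruct (bounded_periodic p0 (2 * PI)) as [M HM].
- generalize PI_RGT_0; lra.
- intros t; eapply is_derive_continuity_pt, HI.
- intros t; unfold p0; rewrite RX, RY; field.
- apply (drift_of_bounded_invariant_form a b p0 p1 p2 theta phi (sqrt c2) M eps r);
    auto.
  now apply sqrt_lt_R0.
Qed.

(** The Cayley-Hamilton relation for a map of determinant one and trace [beta],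
    obtained here from the Pluecker relation between the three determinants. *)
Lemma three_term_recurrence (x y u v p q w beta : R) :
  w <> 0 -> x * v - y * u = w -> u * q - v * p = w -> x * q - y * p = beta * w ->
  p = beta * u - x /\ q = beta * v - y.
Proof.
intros Hw E1 E2 E3; split; apply Rmult_eq_reg_l with w; auto.
- transitivity (beta * w * u - w * x); [|ring].
  rewrite <- E3; rewrite <- E1 at 1; rewrite <- E2; ring.
- transitivity (beta * w * v - w * y); [|ring].
  rewrite <- E3; rewrite <- E1 at 1; rewrite <- E2; ring.
Qed.

(** * Phase-lock areas *)

(** A rotation number shared by [b] and [b + eps] excludes the elliptic case, the
    only one in which the equation for [b] can have a non-integer rotation number. *)
Lemma locking_forces_integer (a b theta phi : R -> R) (eps r : R) :
  (forall t, continuity_pt a t) ->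
  (forall t, a (t + 2 * PI) = a t) -> (forall t, b (t + 2 * PI) = b t) ->
  0 < eps ->
  (forall t, is_derive theta t (a t * cos (theta t) + b t)) ->
  (forall t, is_derive phi t (a t * cos (phi t) + b t + eps)) ->
  is_lim (fun T => theta T / T) p_infty r ->
  is_lim (fun T => phi T / T) p_infty r ->
  exists n : Z, r = IZR n.
Proof.
intros Ca Pa Pb Heps Hth Hphi Hl Hl'.
assert (Dth : forall t, ex_derive theta t) by (intros t; eexists; apply Hth).
destruct (linear_solution_of_angle a b theta Ca Hth) as [rho [Hrho L0]].
set (X := fun t => rho t * cos (theta t / 2)) in L0.
set (Y := fun t => rho t * sin (theta t / 2)) in L0.
assert (L1 := linear_solution_shift a b X Y _ Pa Pb L0).
assert (L2 := linear_solution_shift a b _ _ _ Pa Pb L1); cbv beta in L2.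
pose (w := X 0 * Y (0 + 2 * PI) - Y 0 * X (0 + 2 * PI)).
assert (W : forall t, X t * Y (t + 2 * PI) - Y t * X (t + 2 * PI) = w).
{ intros t; apply (wronskian_constant a b X Y _ _ L0 L1 t 0). }
destruct (Req_dec w 0) as [Hw | Hw].
(* [w] is the product of the two radii with the sine of the half-increment. *)
{ apply (integer_rotation_of_closed_direction theta); auto.
  intros t; specialize (W t); rewrite Hw in W.
  replace ((theta (t + 2 * PI) - theta t) / 2)
    with (theta (t + 2 * PI) / 2 - theta t / 2) by field.
  rewrite sin_minus.
  apply Rmult_eq_reg_l with (rho t * rho (t + 2 * PI)).
  - rewrite Rmult_0_r, <- W; unfold X, Y; ring.
  - apply Rgt_not_eq, Rmult_lt_0_compat; apply Hrho. }
(* The trace of the monodromy: [det (v0, v2) = beta * w] once [v2] is written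
   as [beta v1 - v0]. *)
pose (beta :=
  (X 0 * Y (0 + 2 * PI + 2 * PI) - Y 0 * X (0 + 2 * PI + 2 * PI)) / w).
assert (B : forall t, X t * Y (t + 2 * PI + 2 * PI)
                      - Y t * X (t + 2 * PI + 2 * PI) = beta * w).
{ intros t; unfold beta, Rdiv; rewrite Rmult_assoc, Rinv_l, Rmult_1_r by exact Hw.
  apply (wronskian_constant a b X Y _ _ L0 L2 t 0). }
assert (RXY : forall t,
  X (t + 2 * PI + 2 * PI) = beta * X (t + 2 * PI) - X t /\
  Y (t + 2 * PI + 2 * PI) = beta * Y (t + 2 * PI) - Y t).
{ intros t; apply three_term_recurrence with w; auto. }
assert (RX := fun t => proj1 (RXY t)); assert (RY := fun t => proj2 (RXY t)).
destruct (Rlt_dec (beta * beta) 4) as [Hb | Hb].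
- exfalso.
  apply (no_locking_of_elliptic_multiplier a b theta phi X Y w beta eps r); auto.
- apply (integer_of_real_multiplier rho theta X Y w beta r); auto; try lra;
    intros t; eexists; apply L0.
Qed.

Theorem theorem2 (r : R) (hr : is_phase_lock_value r) :
  exists n : Z, r = IZR n.
Proof.
destruct hr as [[[[[B A] D] omega] delta] [e He]].
assert (H0 := He _ (ball_center _ e)).
assert (H1 : level_set r (B, A, D + e / 2, omega, delta)).
{ apply He; repeat split; try apply ball_center.
  unfold ball; simpl; unfold AbsRing_ball, abs, minus, plus, opp; simpl.
  destruct e as [e Pe]; simpl; apply Rabs_def1; lra. }
destruct H0 as [[Homega Hdelta] [[theta Hth] Hrot]].
destruct H1 as [_ [[phi Hphi] Hrot']].
assert (Hden : forall t, omega * (1 - delta * cos t) <> 0).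
{ intros t; apply Rmult_integral_contrapositive_currified; [exact Homega|].
  destruct (COS_bound t); nra. }
apply (locking_forces_integer
  (fun t => / (omega * (1 - delta * cos t)))
  (fun t => (B + A * sin t) / (omega * (1 - delta * cos t)) + D)
  theta phi (e / 2) r).
- intros t; apply continuity_pt_inv; [|apply Hden].
  apply is_derive_continuity_pt with (omega * (delta * sin t)).
  auto_derive; [exact I | ring].
- intros t; now rewrite cos_plus, cos_2PI, sin_2PI, Rmult_1_r, Rmult_0_r, Rminus_0_r.
- intros t; rewrite cos_plus, sin_plus, cos_2PI, sin_2PI.
  now rewrite !Rmult_1_r, !Rmult_0_r, Rminus_0_r, Rplus_0_r.
- destruct e as [e Pe]; simpl; lra.
- intros t; replace (_ + _) with (torus_field B A D omega delta (theta t) t);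
    [apply Hth | unfold torus_field; unfold Rdiv; ring].
- intros t.
  replace (_ + _) with (torus_field B A (D + e / 2) omega delta (phi t) t);
    [apply Hphi | unfold torus_field; unfold Rdiv; ring].
- now apply Hrot.
- now apply Hrot'.
Qed.
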